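(* Let $\mathbf{A}$ be a relevant algebra and $a,b\in A$. Then (i) $|\,|a|\wedge|b|\,|\leqslant |a|\wedge|b|$; (ii) $\mathit{DFg}^{\mathbf{A}}\{a\}=\{c\in A: a\wedge|d|\leqslant c\text{ for some } d\in A\}$; (iii) $\mathit{DFg}^{\mathbf{A}}\{a\}\cap\mathit{DFg}^{\mathbf{A}}\{b\}=\mathit{DFg}^{\mathbf{A}}\{a\vee b\}$.
   Context: A relevant algebra is an algebra $\langle A;\cdot,\wedge,\vee,\neg\rangle$ such that $\langle A;\cdot\rangle$ is a commutative semigroup, $\langle A;\wedge,\vee\rangle$ is a distributive lattice with order $\leqslant$, and for all $a,b,c$: $\neg\neg a=a\leqslant a\cdot a$; $a\leqslant b$ iff $\neg b\leqslant\neg a$; $a\cdot b\leqslant c$ iff $a\cdot\neg c\leqslant\neg b$; $a\leqslant a\cdot(\neg(b\cdot\neg b)\wedge\neg(c\cdot\neg c))$. Define $x\to y:=\neg(x\cdot\neg y)$ and $|x|:=x\to x$. A deductive filter of $\mathbf{A}$ is a lattice filter $F$ of $\langle A;\wedge,\vee\rangle$ such that $|a|\in F$ for all $a\in A$. $\mathit{DFg}^{\mathbf{A}}X$ denotes the smallest deductive filter of $\mathbf{A}$ containing $X\subseteq A$. *)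

(* Defs.v *)
From HB Require Import structures.
From mathcomp Require Import all_boot all_order.
From mathcomp Require Import classical_sets.

Set Implicit Arguments.
Unset Strict Implicit.
Unset Printing Implicit Defensive.

Import Order.TTheory.

Local Open Scope group_scope.
Local Open Scope order_scope.

(* The inherited semigroup operation [x * y] is the fusion, the inherited
   distributive lattice operations are [Order.meet] and [Order.join], and the
   inherited [<=] is the lattice order. *)
HB.mixin Record isRelevantAlgebra (d : Order.disp_t) A
    of Order.DistrLattice d A & Semigroup A := {
  rneg : A -> A;
  fusionC : commutative (@mul A);
  rnegK : involutive rneg;
  le_fusion_square : forall a : A, a <= (a * a)%g;
  le_rneg : forall a b : A, a <= b <-> rneg b <= rneg a;
  fusion_residual : forall a b c : A,
    (a * b)%g <= c <-> (a * rneg c)%g <= rneg b;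
  le_fusion_meet : forall a b c : A,
    a <= (a * (rneg (b * rneg b) `&` rneg (c * rneg c))%O)%g
}.

#[short(type="relevantAlgebraType")]
HB.structure Definition RelevantAlgebra (d : Order.disp_t) :=
  { A of isRelevantAlgebra d A & Order.DistrLattice d A & Semigroup A }.

Definition rimp (d : Order.disp_t) (A : relevantAlgebraType d) (x y : A) : A :=
  rneg (x * rneg y)%g.

Definition rabs (d : Order.disp_t) (A : relevantAlgebraType d) (x : A) : A :=
  rimp x x.

Local Open Scope classical_set_scope.

Definition lattice_filter (d : Order.disp_t) (L : latticeType d) (F : set L) :=
  [/\ F !=set0,
      forall x y : L, F x -> F y -> F (x `&` y)%O
    & forall x y : L, F x -> (x <= y)%O -> F y].

Definition deductive_filter (d : Order.disp_t) (A : relevantAlgebraType d)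
    (F : set A) :=
  lattice_filter F /\ forall a : A, F (rabs a).

Definition DFg (d : Order.disp_t) (A : relevantAlgebraType d) (X : set A) :
  set A := smallest (@deductive_filter d A) X.

(* [smallest] is an intersection, so membership of the least candidate in the
   class has to be checked; nonemptiness of the result needs [A] inhabited. *)
Lemma DFg_deductive_filter (d : Order.disp_t) (A : relevantAlgebraType d)
  (x0 : A) (X : set A) : deductive_filter (DFg X).
Proof.
have absDFg (x : A) : DFg X (rabs x) by move=> F [[_ absF] _]; apply: absF.
split=> //; split; first by exists (rabs x0).
- move=> x y Fx Fy F FP; have [[[_ FI _] _] _] := FP.
  by apply: FI; [apply: Fx | apply: Fy].
- move=> x y Fx le_xy F FP; have [[[_ _ FU] _] _] := FP.
  by apply: FU le_xy; apply: Fx.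
Qed.

Lemma sub_DFg (d : Order.disp_t) (A : relevantAlgebraType d) (X : set A) :
  X `<=` DFg X.
Proof. exact: sub_gen_smallest. Qed.

Lemma DFg_min (d : Order.disp_t) (A : relevantAlgebraType d) (X F : set A) :
  deductive_filter F -> X `<=` F -> DFg X `<=` F.
Proof. exact: smallest_sub. Qed.

(* Main.v *)
Require Import Defs.
From mathcomp Require Import all_boot all_order.
From mathcomp Require Import classical_sets.

(** With [e := |a| `&` |b|], the axiom [x <= x * e] at [x := ~ e] gives
    [~ e <= e * ~ e], whose contrapositive is [|e| <= e]. Hence the elements
    [|d|] are downward directed, so the up-closure of all [a `&` |d|] is a
    filter, and distributivity turns joins of generators into intersections. *)

Import Order.TTheory.

Lemma rabs_meet_le {d : Order.disp_t} {A : relevantAlgebraType d} (a b : A) :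
  (rabs (rabs a `&` rabs b) <= rabs a `&` rabs b)%O.
Proof.
apply/le_rneg; rewrite [rabs (_ `&` _)%O]/rabs {1}/rimp rnegK fusionC.
exact: le_fusion_meet.
Qed.

Lemma DFg_set1E {d : Order.disp_t} {A : relevantAlgebraType d} (a : A) :
  DFg [set a]%classic = [set c | exists e : A, (a `&` rabs e <= c)%O]%classic.
Proof.
rewrite eqEsubset; split=> [|c [e le_c]]; last first.
  (* The first argument [a] witnesses that the algebra is inhabited. *)
  have [[_ DFgI DFgU] DFg_abs] := DFg_deductive_filter a [set a]%classic.
  by apply: DFgU le_c; apply: DFgI => //; apply: sub_DFg.
apply: DFg_min => [|_ ->]; last by exists a; apply: leIl.
split=> [|x]; last by exists x; apply: leIr.
split; first by exists a; exists a; apply: leIl.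
(* The witness is the meet [d] of |e| and |f| itself: |d| <= [d] lies below both. *)
- move=> x y [e le_x] [f le_y]; exists (rabs e `&` rabs f)%O.
  apply: le_trans (leI2 (lexx a) (rabs_meet_le e f)) _.
  rewrite lexI; apply/andP; split.
  + by apply: le_trans le_x; apply: leI2 => //; apply: leIl.
  + by apply: le_trans le_y; apply: leI2 => //; apply: leIr.
- by move=> x y [e le_x] le_xy; exists e; apply: le_trans le_xy.
Qed.

Lemma DFg_set1I {d : Order.disp_t} {A : relevantAlgebraType d} (a b : A) :
  (DFg [set a] `&` DFg [set b])%classic = DFg [set (a `|` b)%O]%classic.
Proof.
rewrite !DFg_set1E eqEsubset.
split=> [c [[e le_c] [f le_c']]|c [e le_c]].
  exists (rabs e `&` rabs f)%O.
  apply: le_trans (leI2 (lexx _) (rabs_meet_le e f)) _.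
  (* Distributivity turns the left side into a join: the part under [a] is bounded through [e], the
     part under [b] through [f]. *)
  rewrite meetUl leUx; apply/andP; split.
  + by apply: le_trans le_c; apply: leI2 => //; apply: leIl.
  + by apply: le_trans le_c'; apply: leI2 => //; apply: leIr.
(* The same [e] serves both filters, as [a] and [b] lie below their join. *)
by split; exists e; apply: le_trans le_c; apply: leI2; rewrite ?leUl ?leUr.
Qed.

Theorem theorem7p10 (d : Order.disp_t) (A : relevantAlgebraType d) (a b : A) :
  [/\ (rabs (rabs a `&` rabs b) <= rabs a `&` rabs b)%O,
      DFg [set a]%classic =
        [set c | exists e : A, (a `&` rabs e <= c)%O]%classic
    & (DFg [set a] `&` DFg [set b])%classic = DFg [set (a `|` b)%O]%classic].
Proof.
split; [exact: rabs_meet_le | exact: DFg_set1E | exact: DFg_set1I].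
Qed.
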